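(* The only families of update functions that satisfy postulates P1, P2, P3, P4, P5 and P6 are $\mathrm{Upd}_{\mathrm{cond}}$ and $\mathrm{Upd}_{\mathrm{constrain}}$; that is, these two families satisfy P1–P6, and any family $\mathrm{Upd}$ satisfying P1–P6 equals $\mathrm{Upd}_{\mathrm{cond}}$ or $\mathrm{Upd}_{\mathrm{constrain}}$.
   Context: A measure space is a pair $\mathcal{M}=(W,\mathcal{F})$ with $\mathcal{F}$ an algebra of subsets of $W$; $\Delta_{\mathcal{M}}$ is the set of all probability measures on $\mathcal{M}$. An update function on $\mathcal{M}$ is a map $\mathrm{Upd}^{\mathcal{M}}:2^{\Delta_{\mathcal{M}}}\times\mathcal{F}\to 2^{\Delta_{\mathcal{M}}}$ such that $\mathrm{Upd}^{\mathcal{M}}(X,B)=\emptyset$ whenever $\Pr(B)=0$ for all $\Pr\in X$. We write $\mathrm{Upd}^{\mathcal{M}}(\Pr,B)$ for $\mathrm{Upd}^{\mathcal{M}}(\{\Pr\},B)$. A family of update functions $\mathrm{Upd}=\{\mathrm{Upd}^{\mathcal{M}}\}$ consists of one update function for each measure space $\mathcal{M}$. $\Pr(A|B)=\Pr(A\cap B)/\Pr(B)$. Two families: $\mathrm{Upd}_{\mathrm{cond}}^{\mathcal{M}}(X,B)=\{\Pr(\cdot|B):\Pr\in X,\Pr(B)>0\}$ and $\mathrm{Upd}_{\mathrm{constrain}}^{\mathcal{M}}(X,B)=\{\Pr\in X:\Pr(B)=1\}$. A representation shift from $\mathcal{M}=(W,\mathcal{F})$ to $\mathcal{M}'=(W',\mathcal{F}')$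 is a surjection $f:W\to W'$ with $f^{-1}(B)\in\mathcal{F}$ for all $B\in\mathcal{F}'$; it induces $f^*:\Delta_{\mathcal{M}}\to\Delta_{\mathcal{M}'}$, $(f^*(\Pr))(A)=\Pr(f^{-1}(A))$, and $f^*(X)=\{f^*(\Pr):\Pr\in X\}$. Postulates (each required for all measure spaces $\mathcal{M}=(W,\mathcal{F})$, all $X\subseteq\Delta_{\mathcal{M}}$ and all $B,C\in\mathcal{F}$ unless stated otherwise): P1: $\mathrm{Upd}^{\mathcal{M}}(X,B)\subseteq\{\Pr\in\Delta_{\mathcal{M}}:\Pr(B)=1\}$. P2: for every representation shift $f$ from $\mathcal{M}$ to $\mathcal{M}'=(W',\mathcal{F}')$, every $X\subseteq\Delta_{\mathcal{M}}$ and $B\in\mathcal{F}'$: $\mathrm{Upd}^{\mathcal{M}'}(f^*(X),B)=f^*(\mathrm{Upd}^{\mathcal{M}}(X,f^{-1}(B)))$. P3: $\mathrm{Upd}^{\mathcal{M}}(\mathrm{Upd}^{\mathcal{M}}(X,B),C)=\mathrm{Upd}^{\mathcal{M}}(X,B\cap C)$. P4: $\mathrm{Upd}^{\mathcal{M}}(X,B)=X$ if $\Pr(B)=1$ for all $\Pr\in X$. P5: $\mathrm{Upd}^{\mathcal{M}}(X,B)=\bigcup_{\Pr\in X}\mathrm{Upd}^{\mathcal{M}}(\Pr,B)$. P6$'$: $|\mathrm{Upd}^{\mathcal{M}}(\Pr,B)|\le 1$ for all $\Pr\in\Delta_{\mathcal{M}}$, $B\in\mathcal{F}$. P6$''$: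 for every $\Pr\in\Delta_{\mathcal{M}}$ there is a constant $c$ such that for all $A,B\in\mathcal{F}$ and all $\Pr'\in\mathrm{Upd}^{\mathcal{M}}(\Pr,B)$, $\Pr'(A)\le c\Pr(A|B)$. P6: either P6$'$ holds for all measure spaces or P6$''$ holds for all measure spaces. *)

(* Defs.v *)
From Stdlib Require Import Reals.
Open Scope R_scope.
Set Implicit Arguments.

(** A measure space (W, F): F is an algebra of subsets of W (subsets are
    predicates W -> Prop).  Closure under intersection is redundant
    (follows from complement + union up to extensionality) but is included
    for convenience. *)
Record MeasSpace := {
  W : Type;
  F : (W -> Prop) -> Prop;
  F_full : F (fun _ => True);
  F_compl : forall A, F A -> F (fun w => ~ A w);
  F_union : forall A B, F A -> F B -> F (fun w => A w \/ B w);
  F_inter : forall A B, F A -> F B -> F (fun w => A w /\ B w)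
}.

Definition Meas (M : MeasSpace) := { A : W M -> Prop | F M A }.

Definition fullM (M : MeasSpace) : Meas M := exist _ _ (F_full M).
Definition interM (M : MeasSpace) (A B : Meas M) : Meas M :=
  exist _ _ (@F_inter M _ _ (proj2_sig A) (proj2_sig B)).
Definition unionM (M : MeasSpace) (A B : Meas M) : Meas M :=
  exist _ _ (@F_union M _ _ (proj2_sig A) (proj2_sig B)).
Definition disjointM (M : MeasSpace) (A B : Meas M) : Prop :=
  forall w, proj1_sig A w -> proj1_sig B w -> False.

Record Prob (M : MeasSpace) := {
  pr :> Meas M -> R;
  pr_nonneg : forall A, 0 <= pr A;
  pr_full : pr (fullM M) = 1;
  pr_add : forall A B, disjointM A B -> pr (unionM A B) = pr A + pr B
}.

Definition PSet (M : MeasSpace) := Prob M -> Prop.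
Definition seteq (M : MeasSpace) (X Y : PSet M) : Prop := forall P, X P <-> Y P.
Definition single (M : MeasSpace) (P : Prob M) : PSet M := fun Q => Q = P.

Definition Family := forall M : MeasSpace, PSet M -> Meas M -> PSet M.

Definition is_update_family (U : Family) : Prop :=
  forall (M : MeasSpace) (X : PSet M) (B : Meas M),
    (forall P, X P -> P B = 0) -> forall Q, ~ U M X B Q.

Definition Upd_cond : Family := fun M X B Q =>
  exists P : Prob M, X P /\ 0 < P B /\
    forall A : Meas M, Q A = P (interM A B) / P B.

Definition Upd_constrain : Family := fun M X B Q => X Q /\ Q B = 1.

Definition preimM {M M' : MeasSpace} (f : W M -> W M')
  (Hf : forall B, F M' B -> F M (fun w => B (f w))) (B : Meas M') : Meas M :=
  exist _ _ (Hf _ (proj2_sig B)).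

Definition pushSet {M M' : MeasSpace} (f : W M -> W M')
  (Hf : forall B, F M' B -> F M (fun w => B (f w))) (X : PSet M) : PSet M' :=
  fun Q => exists P : Prob M, X P /\ forall A : Meas M', Q A = P (preimM _ Hf A).

Definition P1 (U : Family) : Prop :=
  forall M (X : PSet M) (B : Meas M) Q, U M X B Q -> Q B = 1.

Definition P2 (U : Family) : Prop :=
  forall (M M' : MeasSpace) (f : W M -> W M'),
    (forall y : W M', exists x, f x = y) ->
    forall (Hf : forall B, F M' B -> F M (fun w => B (f w))),
    forall (X : PSet M) (B : Meas M'),
      seteq (U M' (pushSet _ Hf X) B) (pushSet _ Hf (U M X (preimM _ Hf B))).

Definition P3 (U : Family) : Prop :=
  forall M (X : PSet M) (B C : Meas M),
    seteq (U M (U M X B) C) (U M X (interM B C)).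

Definition P4 (U : Family) : Prop :=
  forall M (X : PSet M) (B : Meas M),
    (forall P, X P -> P B = 1) -> seteq (U M X B) X.

Definition P5 (U : Family) : Prop :=
  forall M (X : PSet M) (B : Meas M),
    seteq (U M X B) (fun Q => exists P, X P /\ U M (single P) B Q).

Definition P6' (U : Family) (M : MeasSpace) : Prop :=
  forall (P : Prob M) (B : Meas M) Q1 Q2,
    U M (single P) B Q1 -> U M (single P) B Q2 -> Q1 = Q2.

Definition P6'' (U : Family) (M : MeasSpace) : Prop :=
  forall P : Prob M, exists c : R,
    forall (A B : Meas M) (Q : Prob M),
      U M (single P) B Q -> Q A <= c * (P (interM A B) / P B).

Definition P6 (U : Family) : Prop :=
  (forall M, P6' U M) \/ (forall M, P6'' U M).

Definition all_postulates (U : Family) : Prop :=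
  P1 U /\ P2 U /\ P3 U /\ P4 U /\ P5 U /\ P6 U.

Definition fam_eq (U V : Family) : Prop :=
  forall M (X : PSet M) (B : Meas M), seteq (U M X B) (V M X B).

(* Main.v *)
(* By P2, whether some Q in Upd(P,B) has Q(A) = s, for A a subset of B, depends
   only on p = P(A), q = P(B \ A) and s, so everything can be computed with Lebesgue measure on the algebra of
   finite unions of intervals.  The heart is that s = p / (p + q).
   Under P6' the value s is a function of p for fixed p + q, additive because
   disjoint pieces can be merged, and bounded, hence linear.
   Under P6'' a triple with s > p / (p + q) can be applied twice in a row: after
   updating Lebesgue measure to Q, choose a second event on which Q again shows
   the numbers (p, q), made of pieces as small (inside A) and as large (inside
   B \ A) as possible for Lebesgue measure.  By P3 this is again one update of
   Lebesgue measure, with the same s but with smaller odds p / q; iterating, the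
   density s (p + q) / p becomes unbounded.
   So every update by an event with 0 < P(B) < 1 is either empty or P( . | B).
   Nonemptiness depends on P(B) only; by P3 it is inherited by larger values
   and by products, so it holds for all values in (0,1) or for none. *)
Require Import Defs.
From Stdlib Require Import Reals Lra Psatz List.
From Stdlib Require Import Classical ClassicalEpsilon FunctionalExtensionality
  PropExtensionality ProofIrrelevance.
From Coquelicot Require Import Coquelicot.
Import ListNotations.
Open Scope R_scope.
Set Implicit Arguments.

(** * Finitely additive probabilities *)

Lemma pred_ext (T : Type) (A B : T -> Prop) : (forall x, A x <-> B x) -> A = B.
Proof.
intros H; apply functional_extensionality; intros x.
now apply propositional_extensionality.
Qed.

Lemma meas_ext (M : MeasSpace) (A B : Meas M) :
  (forall w, proj1_sig A w <-> proj1_sig B w) -> A = B.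
Proof.
destruct A as [A HA], B as [B HB]; simpl; intros H.
assert (A = B) by now apply pred_ext.
subst B; f_equal; apply proof_irrelevance.
Qed.

Lemma prob_ext (M : MeasSpace) (P Q : Prob M) : (forall A, P A = Q A) -> P = Q.
Proof.
destruct P as [p p0 p1 pa], Q as [q q0 q1 qa]; simpl; intros H.
assert (p = q) by now apply functional_extensionality.
subst q; f_equal; apply proof_irrelevance.
Qed.

Definition complM (M : MeasSpace) (A : Meas M) : Meas M :=
  exist _ _ (@F_compl M _ (proj2_sig A)).
Definition diffM (M : MeasSpace) (A B : Meas M) : Meas M := interM A (complM B).

Section Prob.
Variables (M : MeasSpace) (P : Prob M).

Lemma pr_split (A B C : Meas M) :
  (forall w, proj1_sig C w <-> proj1_sig A w \/ proj1_sig B w) ->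
  (forall w, proj1_sig A w -> proj1_sig B w -> False) -> P C = P A + P B.
Proof.
intros HC Hd; rewrite <- pr_add by exact Hd; f_equal; now apply meas_ext.
Qed.

Lemma pr_compl (A : Meas M) : P (complM A) = 1 - P A.
Proof.
enough (P (fullM M) = P A + P (complM A)) by (rewrite pr_full in *; lra).
apply pr_split; simpl; [intros w; pose proof (classic (proj1_sig A w))|]; tauto.
Qed.

(** An empty event is disjoint from itself and equal to its union with itself. *)
Lemma pr_empty (A : Meas M) : (forall w, ~ proj1_sig A w) -> P A = 0.
Proof.
intros H; enough (P A = P A + P A) by lra.
apply pr_split; firstorder.
Qed.

Lemma pr_diff (A B : Meas M) : P (diffM A B) = P A - P (interM A B).
Proof.
enough (P A = P (interM A B) + P (diffM A B)) by lra.
apply pr_split; simpl; [intros w; pose proof (classic (proj1_sig B w))|]; tauto.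
Qed.

Lemma pr_diff_sub (A B : Meas M) :
  (forall w, proj1_sig B w -> proj1_sig A w) -> P (diffM A B) = P A - P B.
Proof.
intros H; rewrite pr_diff; f_equal; f_equal; f_equal.
apply meas_ext; simpl; firstorder.
Qed.

Lemma pr_mono (A B : Meas M) :
  (forall w, proj1_sig A w -> proj1_sig B w) -> P A <= P B.
Proof.
intros H; pose proof (pr_diff_sub B A H); pose proof (pr_nonneg P (diffM B A)).
lra.
Qed.

Lemma pr_le1 (A : Meas M) : P A <= 1.
Proof. rewrite <- (pr_full P); apply pr_mono; simpl; auto. Qed.

Lemma pr_inter_of_one (A B : Meas M) : P B = 1 -> P (interM A B) = P A.
Proof.
intros H; pose proof (pr_diff A B); pose proof (pr_nonneg P (diffM A B)).
assert (P (diffM A B) <= P (complM B)) by (apply pr_mono; simpl; tauto).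
rewrite pr_compl in *; lra.
Qed.

Lemma pr_pos_ex (A : Meas M) : 0 < P A -> exists w, proj1_sig A w.
Proof.
intros H; apply NNPP; intros N.
rewrite pr_empty in H; [lra|intros w Hw; apply N; now exists w].
Qed.

Lemma pr_lt1_ex (A : Meas M) : P A < 1 -> exists w, ~ proj1_sig A w.
Proof.
intros H; apply (@pr_pos_ex (complM A)); rewrite pr_compl; lra.
Qed.

End Prob.

Definition cond_prob (M : MeasSpace) (P : Prob M) (B : Meas M) (H : 0 < P B) : Prob M.
Proof.
refine {| pr := fun A => P (interM A B) / P B |}.
- intros A; apply Rle_mult_inv_pos; [apply pr_nonneg|exact H].
- rewrite (meas_ext (interM (fullM M) B) B) by (simpl; tauto).
  field; lra.
- intros A C HAC; rewrite (pr_split P (interM A B) (interM C B)).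
  + field; lra.
  + simpl; tauto.
  + simpl; intros w [h _] [h' _]; exact (HAC w h h').
Defined.

Definition push_prob {M M' : MeasSpace} (f : W M -> W M')
  (Hf : forall B, F M' B -> F M (fun w => B (f w))) (P : Prob M) : Prob M'.
Proof.
refine {| pr := fun A => P (preimM f Hf A) |}.
- intros A; apply pr_nonneg.
- rewrite <- (pr_full P); f_equal; now apply meas_ext.
- intros A C HAC; apply pr_split; simpl; [tauto|intros w; apply HAC].
Defined.

Lemma pushSet_single (M M' : MeasSpace) (f : W M -> W M')
  (Hf : forall B, F M' B -> F M (fun w => B (f w))) (P : Prob M) :
  pushSet f Hf (single P) = single (push_prob f Hf P).
Proof.
apply pred_ext; intros Q; unfold pushSet, single; split.
- intros (P' & -> & H); apply prob_ext; exact H.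
- intros ->; exists P; now split.
Qed.

(** * Conditioning and constraining satisfy the postulates *)

Lemma cond_update : is_update_family Upd_cond.
Proof.
intros M X B H Q (P & HP & HB & _); specialize (H P HP); lra.
Qed.

Lemma cond_postulates : all_postulates Upd_cond.
Proof.
(* The bullets are P1 to P5 in order; P6 is then met through P6'. *)
refine (conj _ (conj _ (conj _ (conj _ (conj _ (or_introl _)))))).
- intros M X B Q (P & _ & HB & H); rewrite H.
  rewrite (meas_ext (interM B B) B) by (simpl; tauto); field; lra.
- intros M M' f _ Hf X B Q.
  assert (EI : forall A, preimM f Hf (interM A B) = interM (preimM f Hf A) (preimM f Hf B))
    by (intros A; now apply meas_ext).
  split.
  + intros (P' & (P & HP & HP') & HB & H); rewrite HP' in HB.
    exists (cond_prob P _ HB); split.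
    * exists P; split; [exact HP|split; [exact HB|reflexivity]].
    * intros A; rewrite H, !HP', EI; reflexivity.
  + intros (P' & (P & HP & HB & HP') & H).
    exists (push_prob f Hf P); split; [exists P; now split|].
    split; [exact HB|]; intros A; simpl; rewrite H, HP', EI; reflexivity.
- intros M X B C Q.
  assert (EI : forall A, interM (interM A C) B = interM A (interM B C))
    by (intros A; apply meas_ext; simpl; tauto).
  assert (EC : interM C B = interM B C) by (apply meas_ext; simpl; tauto).
  split.
  + intros (P' & (P & HP & HB & HP') & HC & H).
    assert (E : P (interM B C) = P' C * P B) by (rewrite HP', EC; field; lra).
    exists P; split; [exact HP|].
    rewrite E; split; [now apply Rmult_lt_0_compat|].
    intros A; rewrite H, HP', EI; field; lra.
  + intros (P & HP & HBC & H).
    assert (HB : 0 < P B)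
      by (eapply Rlt_le_trans; [exact HBC|apply pr_mono; simpl; tauto]).
    (* The intermediate measure is [P] conditioned on [B]; the rest is the chain rule. *)
    exists (cond_prob P _ HB); split; [exists P; split; [exact HP|now split]|].
    simpl; rewrite EC; split; [now apply Rdiv_lt_0_compat|].
    intros A; rewrite H, EI; field; lra.
- intros M X B H P; split.
  + intros (P' & HP' & HB & E); specialize (H P' HP').
    replace P with P'; [exact HP'|]; apply prob_ext; intros A.
    rewrite E, pr_inter_of_one, H; [field|assumption].
  + intros HP; specialize (H P HP); exists P; split; [exact HP|].
    split; [lra|]; intros A; rewrite pr_inter_of_one, H; [field|assumption].
- intros M X B Q; split.
  + intros (P & HP & R); exists P; split; [exact HP|]; exists P; now split.
  + intros (P & HP & P' & E & R); unfold single in E; subst P'.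
    exists P; now split.
- intros M P B Q1 Q2 (P1 & -> & _ & H1) (P2 & -> & _ & H2).
  apply prob_ext; intros A; now rewrite H1, H2.
Qed.

Lemma constrain_update : is_update_family Upd_constrain.
Proof. intros M X B H Q (HX & HB); rewrite (H Q HX) in HB; lra. Qed.

Lemma constrain_postulates : all_postulates Upd_constrain.
Proof.
refine (conj _ (conj _ (conj _ (conj _ (conj _ (or_introl _)))))).
- now intros M X B Q [_ H].
- intros M M' f _ Hf X B Q; split.
  + intros ((P & HP & H) & HB); exists P; split; [split|]; trivial.
    now rewrite <- HB, H.
  + intros (P & [HP HB] & H); split; [now exists P|now rewrite H].
- intros M X B C Q; split.
  + intros [[HX HB] HC]; split; [exact HX|].
    rewrite (meas_ext (interM B C) (interM C B)) by (simpl; tauto).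
    now rewrite pr_inter_of_one.
  + intros [HX HBC].
    repeat split; trivial; (apply Rle_antisym; [apply pr_le1|]);
    rewrite <- HBC; apply pr_mono; simpl; tauto.
- intros M X B H P; split; [now intros [HP _]|]; intros HP; split; auto.
- intros M X B Q; split.
  + intros [HP HB]; exists Q; split; [exact HP|now split].
  + intros (P & HP & E & HB); unfold single in E; subst P; now split.
- intros M P B Q1 Q2 [E1 _] [E2 _]; unfold single in *; congruence.
Qed.

(** * Lebesgue measure on finite unions of intervals *)

(** The breakpoints in [l] cut the line into cells closed on the left and open on the right; this
    relation says that two points share a cell. *)
Definition same_side (l : list R) (x y : R) : Prop :=
  forall z, In z l -> (z <= x <-> z <= y).

(** The carrier is the whole line although [leb] lives on [0,1]: points outside serve as null
    witnesses of nonemptiness. *)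
Definition interval_space : MeasSpace.
Proof.
refine {| W := R;
  F := fun A => exists l, forall x y, same_side l x y -> (A x <-> A y) |}.
- exists []; tauto.
- intros A [l H]; exists l; intros x y Hxy; rewrite (H x y Hxy); tauto.
- intros A B [l H] [l' H']; exists (l ++ l'); intros x y Hxy.
  rewrite (H x y), (H' x y); [tauto| |];
  intros z Hz; apply Hxy, in_or_app; tauto.
- intros A B [l H] [l' H']; exists (l ++ l'); intros x y Hxy.
  rewrite (H x y), (H' x y); [tauto| |];
  intros z Hz; apply Hxy, in_or_app; tauto.
Defined.

Definition ind (A : R -> Prop) (x : R) : R :=
  if excluded_middle_informative (A x) then 1 else 0.

Lemma ex_RInt_piecewise (f : R -> R) (l : list R) : forall a b, a <= b ->
  (forall x y, a < x < b -> a < y < b -> same_side l x y -> f x = f y) ->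
  ex_RInt f a b.
Proof.
induction l as [|z l IH]; intros a b Hab H.
- apply ex_RInt_ext with (fun _ => f ((a + b) / 2)); [|apply ex_RInt_const].
  rewrite Rmin_left, Rmax_right by lra; intros x Hx.
  apply H; [lra|lra|intros z []].
- destruct (Rle_lt_dec z a) as [Hza|Hza]; [|destruct (Rle_lt_dec b z) as [Hbz|Hbz]].
  + apply IH; [exact Hab|]; intros x y Hx Hy S; apply H; trivial.
    intros t [<-|Ht]; [lra|now apply S].
  + apply IH; [exact Hab|]; intros x y Hx Hy S; apply H; trivial.
    intros t [<-|Ht]; [lra|now apply S].
  + apply ex_RInt_Chasles with z; apply IH; try lra;
    intros x y Hx Hy S; (apply H; [lra|lra|]);
    intros t [<-|Ht]; try (now apply S); lra.
Qed.

Lemma ex_RInt_ind (A : Meas interval_space) : ex_RInt (ind (proj1_sig A)) 0 1.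
Proof.
destruct A as [A [l H]]; simpl.
apply ex_RInt_piecewise with l; [lra|]; intros x y _ _ S; unfold ind.
specialize (H x y S).
do 2 destruct excluded_middle_informative; tauto.
Qed.

Definition leb : Prob interval_space.
Proof.
refine {| pr := fun A : Meas interval_space => RInt (ind (proj1_sig A)) 0 1 |}.
- intros A; apply RInt_ge_0; [lra|apply ex_RInt_ind|].
  intros x _; unfold ind; destruct excluded_middle_informative; lra.
- transitivity (RInt (fun _ => 1) 0 1);
    [|rewrite RInt_const; unfold scal; simpl; unfold mult; simpl; ring].
  apply RInt_ext; intros x _; unfold ind; simpl.
  destruct excluded_middle_informative; tauto.
- intros A B H; rewrite <- (@RInt_plus R_CompleteNormedModule); try apply ex_RInt_ind.
  apply RInt_ext; intros x _; unfold ind, plus; simpl.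
  specialize (H x).
  repeat destruct excluded_middle_informative; try tauto; lra.
Defined.

Definition Ico (a b : R) : Meas interval_space.
Proof.
exists (fun x => a <= x < b); exists [a; b]; intros x y S.
pose proof (S a (or_introl eq_refl)) as Ha.
pose proof (S b (or_intror (or_introl eq_refl))) as Hb.
split; intros [H1 H2]; (split; [tauto|apply Rnot_le_lt; intros H3]);
[apply (Rlt_not_le _ _ H2)|apply (Rlt_not_le _ _ H2)]; tauto.
Defined.

Lemma leb_Ico (a b : R) : 0 <= a -> a <= b -> b <= 1 -> leb (Ico a b) = b - a.
Proof.
intros Ha Hab Hb; simpl; apply is_RInt_unique.
assert (E : forall v x y, x <= y ->
  (forall t, x < t < y -> ind (fun x : R => a <= x < b) t = v) ->
  is_RInt (ind (fun x : R => a <= x < b)) x y (v * (y - x))).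
{ intros v x y Hxy H; apply is_RInt_ext with (fun _ => v).
  - rewrite Rmin_left, Rmax_right by lra; intros t Ht; now rewrite H.
  - replace (v * (y - x)) with (scal (y - x) v); [apply @is_RInt_const|].
    unfold scal; simpl; unfold mult; simpl; ring. }
pose proof (@is_RInt_Chasles R_NormedModule) as C.
replace (b - a) with (0 * (a - 0) + (1 * (b - a) + 0 * (1 - b))) by ring.
refine (C _ 0 a 1 _ _ _ (C _ a b 1 _ _ _ _));
apply E; trivial; intros t Ht; unfold ind;
destruct excluded_middle_informative; lra.
Qed.

Lemma leb_null (A : Meas interval_space) :
  (forall x, 0 < x < 1 -> ~ proj1_sig A x) -> leb A = 0.
Proof.
intros H; simpl; transitivity (RInt (fun _ => 0) 0 1).
- apply RInt_ext; rewrite Rmin_left, Rmax_right by lra; intros x Hx; unfold ind.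
  destruct excluded_middle_informative; [exfalso; now apply (H x)|reflexivity].
- rewrite RInt_const; unfold scal; simpl; unfold mult; simpl; ring.
Qed.

Lemma leb_Ico_le (x y : R) : x <= y -> leb (Ico x y) <= y - x.
Proof.
(* Clamping both endpoints to [0,1] leaves the Lebesgue mass unchanged. *)
intros H; set (a := Rmax 0 (Rmin 1 x)); set (b := Rmax 0 (Rmin 1 y)).
assert (0 <= a /\ a <= b /\ b <= 1 /\ b - a <= y - x) as (? & ? & ? & ?).
{ unfold a, b, Rmax, Rmin; repeat destruct Rle_dec; lra. }
apply Rle_trans with (b - a); [|assumption].
rewrite <- leb_Ico by assumption; right; simpl; apply RInt_ext.
rewrite Rmin_left, Rmax_right by lra; intros t Ht; unfold ind.
unfold a, b, Rmax, Rmin; do 2 destruct excluded_middle_informative; try reflexivity;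
repeat destruct Rle_dec; lra.
Qed.

(** Finite additivity alone gives no continuity; this bound makes the mass of [[a,x)] continuous in
    [x], so that pieces of prescribed mass exist. *)
Definition Ico_lipschitz (mu : Prob interval_space) (L : R) : Prop :=
  forall x y, x <= y -> mu (Ico x y) <= L * (y - x).

Lemma Ico_concat (mu : Prob interval_space) (a b c : R) :
  a <= b <= c -> mu (Ico a c) = mu (Ico a b) + mu (Ico b c).
Proof.
intros H; apply pr_split; simpl; intros w.
- destruct (Rlt_le_dec w b); lra.
- lra.
Qed.

Lemma continuity_mass (mu : Prob interval_space) (L a : R) :
  Ico_lipschitz mu L -> continuity (fun x => mu (Ico a x)).
Proof.
intros HL.
assert (K : forall x y, x <= y ->
  mu (Ico a x) <= mu (Ico a y) <= mu (Ico a x) + L * (y - x)).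
{ intros x y Hxy; split; [apply pr_mono; simpl; intros; lra|].
  apply Rle_trans with (mu (Ico a x) + mu (Ico x y));
    [|apply Rplus_le_compat_l, HL, Hxy].
  rewrite <- pr_add by (intros w; simpl; lra).
  apply pr_mono; simpl; intros; destruct (Rlt_le_dec w x); lra. }
(* [Rabs L + 1] is positive whatever the sign of [L]. *)
intros x eps He; exists (eps / (Rabs L + 1)).
pose proof (Rabs_pos L); pose proof (Rle_abs L).
split; [apply Rdiv_lt_0_compat; lra|].
simpl; unfold Rdist; intros y [_ Hy].
apply (Rmult_lt_compat_l (Rabs L + 1)) in Hy; [|lra].
replace ((Rabs L + 1) * (eps / (Rabs L + 1))) with eps in Hy by (field; lra).
apply Rle_lt_trans with (2 := Hy).
destruct (Rle_lt_dec x y) as [h|h].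
- specialize (K x y h); rewrite (Rabs_pos_eq (_ - x)), Rabs_pos_eq by lra; nra.
- specialize (K y x (Rlt_le _ _ h)).
  rewrite (Rabs_minus_sym y x), (Rabs_minus_sym (mu (Ico a y))).
  rewrite (Rabs_pos_eq (x - _)), Rabs_pos_eq by lra; nra.
Qed.

Lemma IVT_between (f : R -> R) (a b y : R) :
  continuity f -> a <= b -> f a <= y <= f b -> exists x, a <= x <= b /\ f x = y.
Proof.
intros Hf Hab Hy.
destruct (IVT_cor (fun x => f x - y) a b) as [x [Hx E]]; trivial.
- apply continuity_minus; [exact Hf|].
  intros x; apply continuity_const; now intros ? ?.
- nra.
- exists x; split; [exact Hx|lra].
Qed.

(* The window starts at a maximum of [mu(I) nu([a,x)) - nu(I) mu([a,x))], which
   vanishes at both ends of [I = [a,b)], and wraps around [b] when it has to. *)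
Lemma window_le (mu nu : Prob interval_space) (L L' a b theta : R) :
  Ico_lipschitz mu L -> Ico_lipschitz nu L' -> a <= b -> 0 <= theta <= 1 ->
  0 < mu (Ico a b) ->
  exists V : Meas interval_space,
    (forall w, proj1_sig V w -> a <= w < b) /\
    mu V = theta * mu (Ico a b) /\ nu V <= theta * nu (Ico a b).
Proof.
intros Hmu Hnu Hab Hth Hpos.
pose (m := fun x => mu (Ico a x)); pose (n := fun x => nu (Ico a x)).
assert (Cm : continuity m) by (eapply continuity_mass; eassumption).
assert (Cn : continuity n) by (eapply continuity_mass; eassumption).
assert (m0 : m a = 0) by (apply pr_empty; simpl; intros; lra).
assert (n0 : n a = 0) by (apply pr_empty; simpl; intros; lra).
fold (m b) in *; fold (n b).
pose (G := fun x => m b * n x - n b * m x).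
destruct (continuity_ab_maj G a b Hab) as (u & Hmax & Hu).
{ intros c _; unfold G; apply continuity_pt_minus; apply continuity_pt_mult;
  try (apply continuity_pt_const; now intros ? ?); auto. }
assert (Hmb : 0 <= m u <= m b).
{ split; [apply pr_nonneg|apply pr_mono; simpl; intros; lra]. }
set (tau := theta * m b).
assert (Htau : 0 <= tau <= m b) by (unfold tau; nra).
(* The window runs from [u] to [v], and [x] is 1 if it wraps around [b], else 0. Times [m b], the
   left side is [G v - G u + tau * n b]. *)
assert (main : forall v x, m v - m u + x * m b = tau -> G v <= G u ->
  n v - n u + x * n b <= theta * n b).
{ intros v x E HG; unfold G in HG; apply Rmult_le_reg_l with (m b); [exact Hpos|].
  replace (m b * (theta * n b)) with (tau * n b) by (unfold tau; ring).
  rewrite <- E; nra. }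
destruct (Rle_lt_dec tau (m b - m u)) as [h|h].
- destruct (@IVT_between m u b (m u + tau)) as (v & Hv & Ev); trivial; [lra|lra|].
  assert (E1 : m v = m u + mu (Ico u v)) by (apply Ico_concat; lra).
  assert (E2 : n v = n u + nu (Ico u v)) by (apply Ico_concat; lra).
  exists (Ico u v); split; [simpl; intros; lra|]; split; [lra|].
  specialize (main v 0); specialize (Hmax v); lra.
- destruct (@IVT_between m a u (m u + tau - m b)) as (v & Hv & Ev); trivial; [lra|lra|].
  assert (E1 : m b = m u + mu (Ico u b)) by (apply Ico_concat; lra).
  assert (E2 : n b = n u + nu (Ico u b)) by (apply Ico_concat; lra).
  exists (unionM (Ico a v) (Ico u b)); split; [simpl; intros; lra|].
  rewrite !pr_add by (intros w; simpl; lra); fold (m v) (n v).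
  split; [lra|]; specialize (main v 1); specialize (Hmax v); lra.
Qed.

(** The complement in [[a,b)] of the window that [window_le] gives for [1 - theta]. *)
Lemma window_ge (mu nu : Prob interval_space) (L L' a b theta : R) :
  Ico_lipschitz mu L -> Ico_lipschitz nu L' -> a <= b -> 0 <= theta <= 1 ->
  0 < mu (Ico a b) ->
  exists V : Meas interval_space,
    (forall w, proj1_sig V w -> a <= w < b) /\
    mu V = theta * mu (Ico a b) /\ theta * nu (Ico a b) <= nu V.
Proof.
intros Hmu Hnu Hab Hth Hpos.
destruct (@window_le mu nu L L' a b (1 - theta)) as (V & HV & Em & En); trivial; [lra|].
exists (diffM (Ico a b) V); split; [simpl; tauto|].
rewrite !pr_diff_sub by exact HV; lra.
Qed.

Lemma geometric_domination (d c e : R) :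
  0 <= e < 1 -> (forall n, d <= c * e ^ n) -> d <= 0.
Proof.
intros He H; apply Rnot_lt_le; intros Hd.
assert (Hc : 0 < c) by (specialize (H 0%nat); simpl in H; lra).
destruct (pow_lt_1_zero e) with (y := d / c) as [n Hn].
- rewrite Rabs_pos_eq; lra.
- now apply Rdiv_lt_0_compat.
- specialize (Hn n (le_n n)); specialize (H n).
  pose proof (Rle_abs (e ^ n)).
  assert (c * e ^ n < c * (d / c)) by (apply Rmult_lt_compat_l; lra).
  replace (c * (d / c)) with d in * by (field; lra); lra.
Qed.

(** * Finite quotients of a measure space *)

Definition powerset_space (T : Type) : MeasSpace.
Proof. refine {| W := T; F := fun _ => True |}; trivial. Defined.

Definition pset (T : Type) (S : T -> Prop) : Meas (powerset_space T) := exist _ S I.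

Lemma F_const (M : MeasSpace) (p : Prop) : F M (fun _ => p).
Proof.
destruct (classic p) as [h|h].
- replace (fun _ : W M => p) with (fun _ : W M => True); [apply F_full|].
  now apply pred_ext.
- replace (fun _ : W M => p) with (fun _ : W M => ~ True); [apply F_compl, F_full|].
  now apply pred_ext.
Qed.

(** The quotient map onto three points: [A], [D] and the rest. *)
Definition cells (M : MeasSpace) (A D : Meas M) (w : W M) : option bool :=
  if excluded_middle_informative (proj1_sig A w) then Some true
  else if excluded_middle_informative (proj1_sig D w) then Some false else None.

Lemma cells_measurable (M : MeasSpace) (A D : Meas M)
  (S : W (powerset_space (option bool)) -> Prop) :
  F (powerset_space (option bool)) S -> F M (fun w => S (cells A D w)).
Proof.
intros _; set (N := complM A).
rewrite (@pred_ext _ (fun w => S (cells A D w))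
  (fun w => (proj1_sig A w /\ S (Some true)) \/
  ((proj1_sig (interM D N) w /\ S (Some false)) \/
   (proj1_sig (interM (complM D) N) w /\ S None)))).
- repeat apply F_union; apply F_inter; try apply F_const; apply proj2_sig.
- intros w; unfold cells; simpl.
  repeat destruct excluded_middle_informative; tauto.
Qed.

(** Exactly what makes [cells A D] onto, as a representation shift must be, with [D] as a full
    fibre. *)
Definition proper_pair (M : MeasSpace) (A D : Meas M) : Prop :=
  (exists w, proj1_sig A w) /\ (exists w, proj1_sig D w) /\
  (exists w, ~ proj1_sig (unionM A D) w) /\ disjointM A D.

Lemma cells_surjective (M : MeasSpace) (A D : Meas M) :
  proper_pair A D -> forall y, exists w, cells A D w = y.
Proof.
intros ([a Ha] & [d Hd] & [c Hc] & dis) [[|]|]; [exists a|exists d|exists c];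
unfold cells; repeat destruct excluded_middle_informative; simpl in *;
firstorder.
Qed.

(** Two atoms determine the third, as the total mass is 1. *)
Lemma three_point_ext (P Q : Prob (powerset_space (option bool))) :
  (forall b, P (pset (eq (Some b))) = Q (pset (eq (Some b)))) -> P = Q.
Proof.
set (At := pset (eq (Some true))); set (Af := pset (eq (Some false))).
set (An := pset (eq (@None bool))).
assert (sing : forall (P : Prob (powerset_space (option bool))) S t,
  P (interM S (pset (eq t))) =
  (if excluded_middle_informative (proj1_sig S t) then 1 else 0) * P (pset (eq t))).
{ intros P0 S t; destruct excluded_middle_informative as [h|h].
  - rewrite Rmult_1_l; f_equal; apply meas_ext; simpl; intros w.
    split; [tauto|intros <-; tauto].
  - rewrite Rmult_0_l; apply pr_empty; simpl; intros w [h1 h2]; now subst. }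
assert (dec : forall (P : Prob (powerset_space (option bool))) S,
  P S = P (interM S At) + (P (interM S Af) + P (interM S An))).
{ intros P0 S; rewrite (pr_split P0 (interM S At) (interM S (unionM Af An))).
  - f_equal; apply pr_split; simpl; [tauto|]; intros w [_ <-] [_ h]; discriminate.
  - simpl; intros [[|]|]; intuition discriminate.
  - simpl; intros w [_ <-] [_ [h|h]]; discriminate. }
intros H; apply prob_ext; intros S.
assert (EN : P An = Q An).
{ pose proof (dec P (fullM _)) as e; pose proof (dec Q (fullM _)) as e'.
  rewrite !pr_full in *; unfold At, Af, An in *; rewrite !sing in *; simpl in *.
  repeat destruct excluded_middle_informative; try tauto.
  rewrite !H in *; lra. }
rewrite (dec P S), (dec Q S); unfold At, Af, An in *.
now rewrite !sing, !H, EN.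
Qed.

Lemma two_point_ext (P Q : Prob (powerset_space bool)) :
  P (pset (eq true)) = Q (pset (eq true)) -> P = Q.
Proof.
intros H; apply prob_ext; intros S.
assert (E : forall b, P (pset (eq b)) = Q (pset (eq b))).
{ intros [|]; [exact H|].
  replace (pset (eq false)) with (complM (pset (eq true)));
    [now rewrite !pr_compl, H|].
  apply meas_ext; intros [|]; simpl; intuition congruence. }
destruct (classic (proj1_sig S true)) as [ht|ht];
destruct (classic (proj1_sig S false)) as [hf|hf].
- replace S with (fullM (powerset_space bool)); [now rewrite !pr_full|].
  apply meas_ext; intros [|]; simpl; tauto.
- replace S with (pset (eq true)); [apply E|].
  apply meas_ext; intros [|]; simpl; intuition congruence.
- replace S with (pset (eq false)); [apply E|].
  apply meas_ext; intros [|]; simpl; intuition congruence.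
- rewrite !pr_empty; trivial; intros [|]; trivial.
Qed.

Definition indicator (M : MeasSpace) (B : Meas M) (w : W M) : bool :=
  if excluded_middle_informative (proj1_sig B w) then true else false.

Lemma indicator_measurable (M : MeasSpace) (B : Meas M)
  (S : W (powerset_space bool) -> Prop) :
  F (powerset_space bool) S -> F M (fun w => S (indicator B w)).
Proof.
intros _.
rewrite (@pred_ext _ (fun w => S (indicator B w)) (fun w => (proj1_sig B w /\ S true) \/
  (proj1_sig (complM B) w /\ S false))).
- apply F_union; apply F_inter; try apply F_const; apply proj2_sig.
- intros w; unfold indicator; simpl.
  destruct excluded_middle_informative; tauto.
Qed.

Lemma indicator_surjective (M : MeasSpace) (B : Meas M) :
  (exists w, proj1_sig B w) -> (exists w, ~ proj1_sig B w) ->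
  forall y, exists w, indicator B w = y.
Proof.
intros [b Hb] [c Hc] [|]; [exists b|exists c]; unfold indicator;
destruct excluded_middle_informative; tauto.
Qed.

Lemma proper_pair_sym (M : MeasSpace) (A D : Meas M) :
  proper_pair A D -> proper_pair D A.
Proof.
intros (HA & HD & [w Hw] & dis); repeat split; trivial.
- exists w; simpl in *; tauto.
- intros v Hv Hv'; exact (dis v Hv' Hv).
Qed.

Lemma unionM_comm (M : MeasSpace) (A B : Meas M) : unionM A B = unionM B A.
Proof. apply meas_ext; simpl; tauto. Qed.

(** * Families satisfying the postulates *)

Section Family.
Variable U : Family.
Hypotheses (HU : is_update_family U) (H1 : P1 U) (H2 : P2 U) (H3 : P3 U)
  (H4 : P4 U) (H5 : P5 U).

(** P2 pushes the update along [f] down to the common quotient [N], and P2 along [g] lifts it to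
    [M']. *)
Lemma update_transfer (M M' N : MeasSpace) (f : W M -> W N) (g : W M' -> W N)
  (Hf : forall B, F N B -> F M (fun w => B (f w)))
  (Hg : forall B, F N B -> F M' (fun w => B (g w)))
  (P : Prob M) (P' : Prob M') (S : Meas N) (Q : Prob M) :
  (forall y, exists x, f x = y) -> (forall y, exists x, g x = y) ->
  push_prob f Hf P = push_prob g Hg P' ->
  U (single P) (preimM f Hf S) Q ->
  exists Q', U (single P') (preimM g Hg S) Q' /\
    push_prob f Hf Q = push_prob g Hg Q'.
Proof.
intros sf sg E HQ.
assert (K : U (single (push_prob g Hg P')) S (push_prob f Hf Q)).
{ rewrite <- E, <- pushSet_single; apply H2; [exact sf|]; now exists Q. }
rewrite <- pushSet_single in K; apply H2 in K; [|exact sg].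
destruct K as (Q' & HQ' & E'); exists Q'; split; [exact HQ'|].
now apply prob_ext.
Qed.

(** The common quotient has two points, the event and its complement; both are nonempty because the
    mass lies strictly between 0 and 1. *)
Lemma update_transfer_event (M M' : MeasSpace) (P : Prob M) (P' : Prob M')
  (B : Meas M) (B' : Meas M') (Q : Prob M) :
  0 < P B < 1 -> P B = P' B' -> U (single P) B Q ->
  exists Q', U (single P') B' Q'.
Proof.
intros HB E HQ.
assert (pre : forall (M : MeasSpace) (B : Meas M),
  preimM (M' := powerset_space bool) (indicator B) (indicator_measurable B) (pset (eq true)) = B).
{ intros M0 B0; apply meas_ext; intros w; simpl; unfold indicator.
  destruct excluded_middle_informative; intuition discriminate. }
destruct (@update_transfer M M' (powerset_space bool) (indicator B) (indicator B')
  (indicator_measurable B) (indicator_measurable B') P P' (pset (eq true)) Q)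
  as (Q' & HQ' & _).
- apply indicator_surjective; [apply (pr_pos_ex P B)|apply (pr_lt1_ex P B)]; lra.
- apply indicator_surjective; [apply (pr_pos_ex P' B')|apply (pr_lt1_ex P' B')]; lra.
- apply two_point_ext; simpl pr; now rewrite !pre.
- now rewrite pre.
- exists Q'; now rewrite pre in HQ'.
Qed.

(* By P2 this relation depends only on the three numbers, not on the space
   realizing them: see [splits_realize]. *)
Definition splits (p q s : R) : Prop :=
  exists (M : MeasSpace) (P : Prob M) (A D : Meas M) (Q : Prob M),
    proper_pair A D /\ P A = p /\ P D = q /\ U (single P) (unionM A D) Q /\ Q A = s.

(** Both pairs induce the same measure on three points, so [update_transfer] applies and preserves
    the updated mass of the point standing for [A]. *)
Lemma splits_realize (p q s : R) (M : MeasSpace) (P : Prob M) (A D : Meas M) :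
  splits p q s -> proper_pair A D -> P A = p -> P D = q ->
  exists Q, U (single P) (unionM A D) Q /\ Q A = s.
Proof.
intros (M0 & P0 & A0 & D0 & Q0 & HAD0 & EA0 & ED0 & HQ0 & Es) HAD EA ED.
set (ab := pset (fun x : option bool => x <> None)).
assert (pre_ab : forall (M : MeasSpace) (A D : Meas M),
  preimM (M' := powerset_space (option bool)) (cells A D)
    (@cells_measurable M A D) ab = unionM A D).
{ intros; apply meas_ext; intros w; simpl; unfold cells.
  repeat destruct excluded_middle_informative; intuition discriminate. }
assert (pre_a : forall (M : MeasSpace) (A D : Meas M),
  preimM (M' := powerset_space (option bool)) (cells A D)
    (@cells_measurable M A D) (pset (eq (Some true))) = A).
{ intros; apply meas_ext; intros w; simpl; unfold cells.
  repeat destruct excluded_middle_informative; intuition discriminate. }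
assert (pre_b : forall (M : MeasSpace) (A D : Meas M), disjointM A D ->
  preimM (M' := powerset_space (option bool)) (cells A D)
    (@cells_measurable M A D) (pset (eq (Some false))) = D).
{ intros M' A' D' dis; apply meas_ext; intros w; simpl; unfold cells.
  specialize (dis w).
  repeat destruct excluded_middle_informative; intuition discriminate. }
destruct (@update_transfer M0 M (powerset_space (option bool)) (cells A0 D0)
  (cells A D) (@cells_measurable M0 A0 D0) (@cells_measurable M A D) P0 P ab Q0)
  as (Q & HQ & E).
- now apply cells_surjective.
- now apply cells_surjective.
- apply three_point_ext; intros [|]; simpl pr.
  + rewrite !pre_a; congruence.
  + rewrite !pre_b; [congruence|apply HAD|apply HAD0].
- now rewrite pre_ab.
- rewrite pre_ab in HQ; exists Q; split; [exact HQ|].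
  apply (f_equal (fun R => pr R (pset (eq (Some true))))) in E; simpl pr in E.
  rewrite !pre_a in E; congruence.
Qed.

Lemma splits_intro (M : MeasSpace) (P : Prob M) (A D : Meas M) (Q : Prob M) :
  proper_pair A D -> U (single P) (unionM A D) Q -> splits (P A) (P D) (Q A).
Proof. intros HAD HQ; exists M, P, A, D, Q; auto. Qed.

Lemma splits_compl (p q s : R) : splits p q s -> splits q p (1 - s).
Proof.
intros (M & P & A & D & Q & HAD & <- & <- & HQ & <-).
pose proof (H1 HQ) as E; rewrite pr_add in E by apply HAD.
replace (1 - Q A) with (Q D) by lra.
rewrite unionM_comm in HQ; apply splits_intro; trivial.
now apply proper_pair_sym.
Qed.

Lemma splits_range (p q s : R) : splits p q s -> 0 <= s <= 1.
Proof.
intros (M & P & A & D & Q & _ & _ & _ & _ & <-).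
split; [apply pr_nonneg|apply pr_le1].
Qed.

(* The summands outside [0,1) make the events nonempty even when [a = b]. *)
Definition pad (a b c d : R) : Meas interval_space := unionM (Ico a b) (Ico c d).

Lemma leb_pad (a b c d : R) : 0 <= a <= b -> b <= 1 <= c -> leb (pad a b c d) = b - a.
Proof.
intros Ha Hb; unfold pad; rewrite pr_add by (intros w; simpl; lra).
rewrite leb_Ico, (leb_null (Ico c d)) by (simpl; intros; lra); lra.
Qed.

(** A nonempty update keeps proportions inside the event. Masses 0 and 1 are left to the defining
    property of updates and to P4. *)
Definition split_law : Prop := forall p q s,
  0 <= p -> 0 <= q -> 0 < p + q < 1 -> splits p q s -> s = p / (p + q).

(** * The split law under P6': a bounded additive function *)

Section Unique.
Hypothesis unique : forall M, P6' U M.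

Lemma splits_unique (p q s s' : R) : splits p q s -> splits p q s' -> s = s'.
Proof.
intros HT (M & P & A & D & Q & HAD & EA & ED & HQ & <-).
destruct (splits_realize P HT HAD EA ED) as (Q' & HQ' & <-).
now rewrite (unique HQ HQ').
Qed.

(** The given triple supplies one update [Q] by an event of mass [b]. Cutting this event into pieces
    of mass [x], [y] and [b - (x + y)] and merging two of them in each possible way gives all three
    triples from the same [Q]. *)
Lemma splits_add (b p q s x y : R) :
  b = p + q -> 0 <= p -> 0 <= q -> b < 1 -> 0 <= x -> 0 <= y -> x + y <= b ->
  splits p q s ->
  exists s1 s2, splits x (b - x) s1 /\ splits y (b - y) s2 /\
    splits (x + y) (b - (x + y)) (s1 + s2).
Proof.
intros Eb Hp Hq Hb Hx Hy Hxy HT.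
(* Each event gets a null part in [2,5), and the point 5 stays outside. *)
assert (proper : forall A D : Meas interval_space,
  (exists w, 2 <= w < 5 /\ proj1_sig A w) -> (exists w, 2 <= w < 5 /\ proj1_sig D w) ->
  (forall w, proj1_sig (unionM A D) w -> w < 5) ->
  disjointM A D -> proper_pair A D).
{ intros A D [u [_ Hu]] [v [_ Hv]] H dis.
  repeat split; trivial; [now exists u|now exists v|].
  exists 5; intros h; apply H in h; lra. }
destruct (@splits_realize p q s interval_space leb (pad 0 p 2 3) (pad p b 3 5))
  as (Q & HQ & _); trivial.
- apply proper; [exists 2|exists 3| |intros w]; simpl; intros; lra.
- rewrite leb_pad; lra.
- rewrite leb_pad; lra.
- set (E1 := pad 0 x 2 3); set (E2 := pad x (x + y) 3 4); set (E3 := pad (x + y) b 4 5).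
  assert (tot : unionM (pad 0 p 2 3) (pad p b 3 5) = unionM (unionM E1 E2) E3).
  { apply meas_ext; simpl; intros w.
    destruct (Rlt_le_dec w p), (Rlt_le_dec w x), (Rlt_le_dec w (x + y)),
      (Rlt_le_dec w 3), (Rlt_le_dec w 4); lra. }
  rewrite tot in HQ.
  assert (L1 : leb E1 = x) by (unfold E1; rewrite leb_pad; lra).
  assert (L2 : leb E2 = y) by (unfold E2; rewrite leb_pad; lra).
  assert (L3 : leb E3 = b - (x + y)) by (unfold E3; rewrite leb_pad; lra).
  assert (d12 : disjointM E1 E2) by (intros w; simpl; lra).
  assert (d13 : disjointM E1 E3) by (intros w; simpl; lra).
  assert (d23 : disjointM E2 E3) by (intros w; simpl; lra).
  exists (Q E1), (Q E2); repeat split.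
  + replace (b - x) with (leb (unionM E2 E3)) by (rewrite pr_add; trivial; lra).
    rewrite <- L1; apply splits_intro.
    * apply proper; [exists 2|exists 3| |intros w]; simpl; intros; lra.
    * replace (unionM E1 (unionM E2 E3)) with (unionM (unionM E1 E2) E3); trivial.
      apply meas_ext; simpl; tauto.
  + replace (b - y) with (leb (unionM E1 E3)) by (rewrite pr_add; trivial; lra).
    rewrite <- L2; apply splits_intro.
    * apply proper; [exists 3|exists 2| |intros w]; simpl; intros; lra.
    * replace (unionM E2 (unionM E1 E3)) with (unionM (unionM E1 E2) E3); trivial.
      apply meas_ext; simpl; tauto.
  + rewrite <- pr_add, <- L3 by exact d12.
    replace (x + y) with (leb (unionM E1 E2)) by (rewrite pr_add; trivial; lra).
    apply splits_intro; trivial.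
    apply proper; [exists 2|exists 4| |intros w]; simpl; intros; lra.
Qed.

(* [x |-> s - x/b] is additive, odd about [b/2] and bounded; doubling makes a
   nonzero value unbounded. *)
Lemma unique_split_law : split_law.
Proof.
intros p q s Hp Hq Hpq HT; set (b := p + q).
assert (Hb : 0 < b < 1) by exact Hpq.
set (d := Rabs (s - p / b)).
assert (K : forall n, exists x s', 0 <= x <= b /\ splits x (b - x) s' /\
  d <= Rabs (s' - x / b) * (1 / 2) ^ n).
{ induction n as [|n (x & s' & Hx & HT' & IH)].
  - exists p, s; split; [unfold b; lra|]; split.
    + replace (b - p) with q by (unfold b; ring); exact HT.
    + simpl; fold d; lra.
  - assert (dbl : forall y r, 0 <= y -> 2 * y <= b -> splits y (b - y) r ->
      Rabs (s' - x / b) = Rabs (r - y / b) ->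
      exists x s', 0 <= x <= b /\ splits x (b - x) s' /\
        d <= Rabs (s' - x / b) * (1 / 2) ^ S n).
    { intros y r Hy Hyb HTy E.
      destruct (@splits_add b y (b - y) r y y) as (s1 & s2 & T1 & T2 & T3);
        trivial; try lra.
      (* Uniqueness gives both pieces of mass [y] the same value [r]. *)
      rewrite (splits_unique T1 HTy), (splits_unique T2 HTy) in T3.
      exists (y + y), (r + r); split; [lra|split; [exact T3|]].
      replace (r + r - (y + y) / b) with (2 * (r - y / b)) by (field; lra).
      rewrite Rabs_mult, (Rabs_pos_eq 2) by lra; simpl; rewrite E in IH; lra. }
    (* Doubling must stay below [b], so a point beyond [b/2] is first reflected. *)
    destruct (Rle_lt_dec (2 * x) b) as [h|h].
    + apply dbl with x s'; trivial; lra.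
    + apply dbl with (b - x) (1 - s'); try lra.
      * replace (b - (b - x)) with x by ring; now apply splits_compl.
      * rewrite Rabs_minus_sym; f_equal; field; lra. }
enough (d <= 0).
{ pose proof (Rabs_pos (s - p / b)).
  apply Rminus_diag_uniq; apply NNPP; intros N; apply Rabs_no_R0 in N.
  unfold d in *; lra. }
apply geometric_domination with 1 (1 / 2); [lra|]; intros n.
destruct (K n) as (x & s' & Hx & HT' & IH).
apply Rle_trans with (1 := IH), Rmult_le_compat_r; [apply pow_le; lra|].
apply splits_range in HT'.
assert (0 <= x / b <= 1).
{ split; [apply Rle_mult_inv_pos; lra|].
  apply Rmult_le_reg_r with b; [lra|]; unfold Rdiv.
  rewrite Rmult_assoc, Rinv_l; lra. }
apply Rabs_le; lra.
Qed.

End Unique.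

(** * The split law under P6'': amplifying a deviation *)

Section Bounded.
Variable c : R.
Hypothesis bound : forall (A B : Meas interval_space) (Q : Prob interval_space),
  U (single leb) B Q -> Q A <= c * (leb (interM A B) / leb B).

Lemma update_pos (B : Meas interval_space) (Q : Prob interval_space) :
  U (single leb) B Q -> 0 < leb B.
Proof.
intros HQ; destruct (Rle_lt_or_eq_dec _ _ (pr_nonneg leb B)) as [h|h]; trivial.
exfalso; apply (@HU _ (single leb) B) with Q; [|exact HQ].
intros P ->; now symmetry.
Qed.

(** The bound is evaluated at [B] itself, where P1 gives mass 1. *)
Lemma bound_ge1 (B : Meas interval_space) (Q : Prob interval_space) :
  U (single leb) B Q -> 1 <= c.
Proof.
intros HQ; pose proof (bound B HQ) as h; pose proof (update_pos HQ).
rewrite (H1 HQ), (meas_ext (interM B B) B) in h by (simpl; tauto).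
replace (leb B / leb B) with 1 in h by (field; lra); lra.
Qed.

Lemma update_le (A B : Meas interval_space) (Q : Prob interval_space) :
  U (single leb) B Q -> Q A * leb B <= c * leb A.
Proof.
intros HQ; pose proof (update_pos HQ); pose proof (bound_ge1 HQ).
assert (leb (interM A B) <= leb A) by (apply pr_mono; simpl; tauto).
apply Rle_trans with (c * leb (interM A B)); [|nra].
pose proof (Rmult_le_compat_r (leb B) _ _ (Rlt_le _ _ H) (bound A HQ)) as h.
replace (c * (leb (interM A B) / leb B) * leb B) with (c * leb (interM A B)) in h
  by (field; lra).
exact h.
Qed.

(** This lets the window lemmas be applied to an updated measure. *)
Lemma update_lipschitz (B : Meas interval_space) (Q : Prob interval_space) :
  U (single leb) B Q -> Ico_lipschitz Q (c / leb B).
Proof.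
intros HQ x y Hxy; pose proof (update_pos HQ); pose proof (bound_ge1 HQ).
pose proof (update_le (Ico x y) HQ); pose proof (leb_Ico_le Hxy).
apply Rmult_le_reg_r with (leb B); trivial.
replace (c / leb B * (y - x) * leb B) with (c * (y - x)) by (field; lra).
nra.
Qed.

Lemma leb_lipschitz : Ico_lipschitz leb 1.
Proof. intros x y H; rewrite Rmult_1_l; now apply leb_Ico_le. Qed.

(** The density [s (p + q) / p] is at most [c]; padding keeps the events nonempty when [p] or [q] is
    0. *)
Lemma splits_le (p q s : R) :
  0 <= p -> 0 <= q -> 0 < p + q < 1 -> splits p q s -> s * (p + q) <= c * p.
Proof.
intros Hp Hq Hpq HT; set (A := pad 0 p 2 3); set (D := pad p (p + q) 3 4).
assert (EA : leb A = p) by (unfold A; rewrite leb_pad; lra).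
assert (ED : leb D = q) by (unfold D; rewrite leb_pad; lra).
assert (HAD : proper_pair A D).
{ repeat split; [exists 2|exists 3|exists 4|intros w]; simpl; lra. }
destruct (splits_realize leb HT HAD EA ED) as (Q & HQ & <-).
pose proof (update_le A HQ) as h; rewrite pr_add, EA, ED in h by apply HAD; lra.
Qed.

(* Two successive updates with the numbers [(p, q, s)]: the second one is made on
   a part of [A] of [Q]-mass [p] and small Lebesgue measure and a part of [D] of
   [Q]-mass [q] and large Lebesgue measure, so that by P3 the odds [p / q] at
   least get multiplied by [(p / q) ((1 - s) / s)] while [s] is unchanged. *)
Lemma splits_amplify (p q s : R) :
  0 < p <= s -> 0 < q <= 1 - s -> p + q < 1 -> splits p q s ->
  exists p' q', 0 < p' <= p /\ 0 < q' <= q /\ p' * s <= p * p /\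
    q * q <= q' * (1 - s) /\ splits p' q' s.
Proof.
intros Hp Hq Hpq HT; set (A := Ico 0 p); set (D := Ico p (p + q)).
assert (EA : leb A = p) by (unfold A; rewrite leb_Ico; lra).
assert (ED : leb D = q) by (unfold D; rewrite leb_Ico; lra).
assert (HAD : proper_pair A D).
{ repeat split; [exists 0|exists p|exists 1|intros w]; simpl; lra. }
destruct (splits_realize leb HT HAD EA ED) as (Q & HQ & QA).
assert (QD : Q D = 1 - s).
{ pose proof (H1 HQ) as h; rewrite pr_add in h by apply HAD; lra. }
pose proof (update_lipschitz HQ) as QL.
(* As [Q A = s], the fraction [p / s] has [Q]-mass [p]; it is at most 1 by [p <= s]. The same is
   done in [D] with [q / (1 - s)]. *)
destruct (@window_le Q leb _ _ 0 p (p / s) QL leb_lipschitz) as (A' & HA' & QA' & LA').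
{ lra. }
{ split; [apply Rle_mult_inv_pos; lra|].
  apply Rmult_le_reg_r with s; [lra|]; unfold Rdiv.
  rewrite Rmult_assoc, Rinv_l; lra. }
{ fold A; lra. }
destruct (@window_ge Q leb _ _ p (p + q) (q / (1 - s)) QL leb_lipschitz)
  as (D' & HD' & QD' & LD').
{ lra. }
{ split; [apply Rle_mult_inv_pos; lra|].
  apply Rmult_le_reg_r with (1 - s); [lra|]; unfold Rdiv.
  rewrite Rmult_assoc, Rinv_l; lra. }
{ fold D; lra. }
fold A in QA', LA'; fold D in QD', LD'.
rewrite QA in QA'; rewrite EA in LA'; rewrite QD in QD'; rewrite ED in LD'.
replace (p / s * s) with p in QA' by (field; lra).
replace (q / (1 - s) * (1 - s)) with q in QD' by (field; lra).
apply (Rmult_le_compat_r s) in LA'; [|lra].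
replace (p / s * p * s) with (p * p) in LA' by (field; lra).
apply (Rmult_le_compat_r (1 - s)) in LD'; [|lra].
replace (q / (1 - s) * q * (1 - s)) with (q * q) in LD' by (field; lra).
assert (dis : disjointM A' D').
{ intros w h h'; specialize (HA' w h); specialize (HD' w h'); lra. }
assert (HAD' : proper_pair A' D').
{ repeat split; trivial; [apply (pr_pos_ex Q)|apply (pr_pos_ex Q)|apply (pr_lt1_ex Q)];
  rewrite ?pr_add by exact dis; lra. }
destruct (splits_realize Q HT HAD' QA' QD') as (Q' & HQ' & QA2).
assert (HQ2 : U (single leb) (unionM A' D') Q').
{ rewrite (meas_ext (unionM A' D') (interM (unionM A D) (unionM A' D'))).
  - apply H3, H5; exists Q; now split.
  - simpl; intros w; specialize (HA' w); specialize (HD' w); split; [|tauto].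
    intros [h|h]; [specialize (HA' h)|specialize (HD' h)];
    (split; [|tauto]); lra. }
exists (leb A'), (leb D'); repeat split; trivial.
(* [A'] has [Q]-mass [p > 0], hence positive Lebesgue mass by the density bound. *)
- pose proof (update_le A' HQ); pose proof (bound_ge1 HQ).
  pose proof (update_pos HQ); pose proof (pr_nonneg leb A'); nra.
- rewrite <- EA; apply pr_mono, HA'.
- pose proof (pr_nonneg leb D'); nra.
- rewrite <- ED; apply pr_mono, HD'.
- rewrite <- QA2; now apply splits_intro.
Qed.

(** With [t = 1 - s], each amplification replaces the ratio [x t / (y s)] by at most its square. It
    starts at [e < 1], so it tends to 0, whereas [splits_le] forces it to be at least [t / c]. *)
Lemma no_amplifiable (p q s : R) :
  0 < p <= s -> 0 < q <= 1 - s -> p + q < 1 -> p < s * (p + q) -> ~ splits p q s.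
Proof.
intros Hp Hq Hpq Hs HT; set (t := 1 - s); set (e := p * t / (q * s)).
assert (Hqs : 0 < q * s) by nra.
assert (He : 0 <= e < 1).
{ split; [apply Rle_mult_inv_pos; [unfold t; nra|exact Hqs]|].
  apply Rmult_lt_reg_r with (q * s); [exact Hqs|]; unfold e, Rdiv.
  rewrite Rmult_assoc, Rinv_l by lra; unfold t; lra. }
assert (K : forall n, exists x y, 0 < x <= p /\ 0 < y <= q /\ splits x y s /\
  x * t <= e * e ^ n * (y * s)).
{ induction n as [|n (x & y & Hx & Hy & HTxy & IH)].
  - exists p, q; repeat split; trivial; try lra.
    right; unfold e; simpl; field; nra.
  - destruct (@splits_amplify x y s) as (x' & y' & Hx' & Hy' & X & Y & HT'); trivial;
      try lra.
    exists x', y'; repeat split; trivial; try lra.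
    fold t in Y; simpl.
    assert (He' : 0 <= e ^ n <= 1).
    { split; [apply pow_le; lra|]. rewrite <- (pow1 n); apply pow_incr; lra. }
    set (k := e ^ n) in *.
    assert (Ht : 0 < t) by (unfold t; lra).
    assert (x * t * (x * t) <= e * k * (y * s) * (e * k * (y * s))).
    { apply Rmult_le_compat; trivial; nra. }
    assert (Hxx : x' * t * (s * t) <= e * k * (e * k) * (y * y) * s * s) by nra.
    assert (Hyy : e * k * (e * k) * (y * y) * s * s <= e * k * (e * k) * (y' * t) * s * s).
    { do 2 (apply Rmult_le_compat_r; [lra|]).
      apply Rmult_le_compat_l; [|exact Y]; nra. }
    (* Squaring is weakened to one more factor [e], which keeps the decay geometric. *)
    assert (Hk : e * k * (e * k) <= e * (e * k)) by (apply Rmult_le_compat_r; nra).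
    apply Rmult_le_reg_r with (s * t); [nra|].
    apply Rle_trans with (1 := Hxx), Rle_trans with (1 := Hyy).
    replace (e * k * (e * k) * (y' * t) * s * s)
      with (e * k * (e * k) * (y' * s * (s * t))) by ring.
    replace (e * (e * k) * (y' * s) * (s * t))
      with (e * (e * k) * (y' * s * (s * t))) by ring.
    apply Rmult_le_compat_r; [|exact Hk].
    apply Rmult_le_pos; nra. }
enough (t <= 0) by (unfold t in *; lra).
apply geometric_domination with (c * e) e; [exact He|]; intros n.
destruct (K n) as (x & y & Hx & Hy & HTxy & IH).
assert (Hc : s * (x + y) <= c * x) by (apply splits_le; trivial; lra).
assert (0 < s * y) by nra.
assert (0 <= s * x) by nra.
assert (0 < c) by (apply Rnot_le_lt; intros h; nra).
apply Rmult_le_reg_r with (s * y); [nra|].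
assert (Ht : 0 < t) by (unfold t; lra).
assert (t * (s * y) <= c * (x * t)) by nra.
nra.
Qed.

(** A deviation need not satisfy the size conditions of [no_amplifiable]. It is moved to a small
    piece [V] of [A] on which the density of [Q] is at least that on [A]; the pair of [V] and the
    rest of the event does satisfy them. *)
Lemma splits_upper (p q s : R) :
  0 < p -> 0 < q -> p + q < 1 -> splits p q s -> s * (p + q) <= p.
Proof.
intros Hp Hq Hpq HT; apply Rnot_lt_le; intros Hs; set (b := p + q) in *.
assert (Hb : 0 < b) by (unfold b; lra).
assert (Hs1 : 0 < s) by (apply Rnot_le_lt; intros h; nra).
assert (Hpb : p < b) by (unfold b; lra).
set (A := Ico 0 p); set (D := Ico p b).
assert (EA : leb A = p) by (unfold A; rewrite leb_Ico; lra).
assert (ED : leb D = q) by (unfold D, b in *; rewrite leb_Ico; lra).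
assert (HAD : proper_pair A D).
{ repeat split; [exists 0|exists p|exists 1|intros w]; simpl; unfold b in *; lra. }
destruct (splits_realize leb HT HAD EA ED) as (Q & HQ & QA).
pose proof (bound_ge1 HQ) as Hc.
(* The first term gives [y < p]. The second gives [Q V <= 1 - b] through the density bound, hence
   [b - y <= 1 - Q V]. *)
set (y := Rmin (p / 2) (b * (1 - b) / c)).
assert (Hy : 0 < y < p /\ c * y <= b * (1 - b)).
{ assert (0 < b * (1 - b) / c) by (apply Rdiv_lt_0_compat; unfold b in *; nra).
  assert (Hy : y <= b * (1 - b) / c) by apply Rmin_r.
  assert (y <= p / 2) by apply Rmin_l.
  split; [split; [apply Rmin_pos; lra|lra]|].
  apply (Rmult_le_compat_l c) in Hy; [|lra].
  replace (c * (b * (1 - b) / c)) with (b * (1 - b)) in Hy by (field; lra).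
  exact Hy. }
destruct (@window_ge leb Q _ _ 0 p (y / p) leb_lipschitz (update_lipschitz HQ))
  as (V & HV & LV & QV).
{ lra. }
{ split; [apply Rle_mult_inv_pos; lra|].
  apply Rmult_le_reg_r with p; [lra|]; unfold Rdiv.
  rewrite Rmult_assoc, Rinv_l; lra. }
{ fold A; lra. }
fold A in LV, QV; rewrite EA in LV; rewrite QA in QV.
replace (y / p * p) with y in LV by (field; lra).
set (V' := diffM (unionM A D) V).
assert (sub : forall w, proj1_sig V w -> proj1_sig (unionM A D) w).
{ intros w Hw; left; now apply HV. }
assert (LV' : leb V' = b - y).
{ unfold V'; rewrite pr_diff_sub by exact sub; rewrite pr_add by apply HAD.
  unfold b; lra. }
assert (tot : unionM V V' = unionM A D).
{ apply meas_ext; intros w; specialize (sub w); simpl in *.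
  pose proof (classic (proj1_sig V w)); tauto. }
assert (HVV : proper_pair V V').
{ repeat split.
  - apply (pr_pos_ex leb); lra.
  - apply (pr_pos_ex leb); unfold b in *; lra.
  - rewrite tot; apply HAD.
  - intros w; unfold V'; simpl; tauto. }
assert (HT' : splits y (b - y) (Q V)).
{ rewrite <- LV, <- LV' at 1; apply splits_intro; trivial; now rewrite tot. }
pose proof (update_le V HQ) as HQV; rewrite LV, pr_add, EA, ED in HQV by apply HAD.
fold b in HQV.
assert (Hsy : s * y <= Q V * p).
{ apply (Rmult_le_compat_r p) in QV; [|lra].
  replace (y / p * s * p) with (s * y) in QV by (field; lra); exact QV. }
assert (HyQ : y < Q V * b).
{ apply Rmult_lt_reg_r with p; [lra|].
  apply Rlt_le_trans with (s * y * b); nra. }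
assert (Q V <= 1 - b) by nra.
apply (@no_amplifiable y (b - y) (Q V)); trivial; try lra.
- split; [lra|]; pose proof (pr_nonneg Q V); nra.
Qed.

(** [splits_upper] for the pair and for the swapped pair gives both inequalities; when [p] or [q] is
    0, [splits_le] settles it. *)
Lemma bounded_split_law : split_law.
Proof.
intros p q s Hp Hq Hpq HT; pose proof (splits_range HT).
pose proof (splits_compl HT) as HT'.
apply Rmult_eq_reg_r with (p + q); [|lra].
replace (p / (p + q) * (p + q)) with p by (field; lra).
destruct (Rle_lt_or_eq_dec 0 p Hp) as [h|<-].
- destruct (Rle_lt_or_eq_dec 0 q Hq) as [h'|<-].
  + pose proof (splits_upper h h' (proj2 Hpq) HT).
    assert (Hqp : q + p < 1) by lra.
    pose proof (splits_upper h' h Hqp HT'); lra.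
  + assert (K : (1 - s) * (0 + p) <= c * 0) by (apply splits_le; trivial; lra); nra.
- assert (K : s * (0 + q) <= c * 0) by (apply splits_le; trivial; lra); nra.
Qed.

End Bounded.

Lemma postulate_split_law : P6 U -> split_law.
Proof.
intros [H|H]; [now apply unique_split_law|].
destruct (H interval_space leb) as [c Hc].
now apply bounded_split_law with c.
Qed.

(** * From the split law to the dichotomy *)

Section Law.
Hypothesis law : split_law.

Lemma update_is_cond (M : MeasSpace) (P : Prob M) (B : Meas M) (Q : Prob M) :
  0 < P B < 1 -> U (single P) B Q -> forall A, Q A = P (interM A B) / P B.
Proof.
intros HB HQ A; rewrite <- (pr_inter_of_one Q A B) by now apply (H1 HQ).
set (A' := interM A B); set (D := diffM B A).
assert (tot : unionM A' D = B).
{ apply meas_ext; intros w; simpl; pose proof (classic (proj1_sig A w)); tauto. }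
assert (dis : disjointM A' D) by (intros w; simpl; tauto).
assert (add : forall R : Prob M, R B = R A' + R D).
{ intros R; rewrite <- tot; now apply pr_add. }
destruct (classic (exists w, proj1_sig A' w)) as [hA|hA].
(* [split_law] needs both pieces nonempty; an empty piece has mass 0 under both measures. *)
- destruct (classic (exists w, proj1_sig D w)) as [hD|hD].
  + rewrite add; apply law; try apply pr_nonneg; [now rewrite <- add|].
    apply splits_intro; [|now rewrite tot].
    repeat split; trivial; rewrite tot; apply (pr_lt1_ex P); lra.
  + pose proof (add P) as eP; pose proof (add Q) as eQ; rewrite (H1 HQ) in eQ.
    assert (zD : forall R : Prob M, R D = 0).
    { intros R; apply pr_empty; intros w h; apply hD; now exists w. }
    rewrite zD, Rplus_0_r in eP, eQ; rewrite <- eP, <- eQ; field; lra.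
- assert (zA : forall R : Prob M, R A' = 0).
  { intros R; apply pr_empty; intros w h; apply hA; now exists w. }
  rewrite !zA; field; lra.
Qed.

(** One standard event of mass [b] stands for all of them, by [nonvacuous_iff]. *)
Definition nonvacuous (b : R) : Prop := exists Q, U (single leb) (Ico 0 b) Q.

Lemma nonvacuous_iff (M : MeasSpace) (P : Prob M) (B : Meas M) :
  0 < P B < 1 -> ((exists Q, U (single P) B Q) <-> nonvacuous (P B)).
Proof.
intros HB; assert (E : leb (Ico 0 (P B)) = P B) by (rewrite leb_Ico; lra).
split; intros [Q HQ]; eapply update_transfer_event; [| |exact HQ| | |exact HQ];
rewrite ?E; trivial.
Qed.

Lemma update_interM (M : MeasSpace) (P : Prob M) (B C : Meas M) (Q : Prob M) :
  U (single P) (interM B C) Q <->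
  exists Q', U (single P) B Q' /\ U (single Q') C Q.
Proof.
rewrite <- (H3 (single P) B C Q), (H5 (U (single P) B) C Q); tauto.
Qed.

Lemma Ico_interM (a b : R) : a <= b -> interM (Ico 0 b) (Ico 0 a) = Ico 0 a.
Proof. intros H; apply meas_ext; simpl; intros; lra. Qed.

(** By P3 an update by [[0,a)] passes through one by the larger [[0,b)]. *)
Lemma nonvacuous_mono (a b : R) : a <= b -> nonvacuous a -> nonvacuous b.
Proof.
intros Hab [Q HQ]; rewrite <- (Ico_interM Hab), update_interM in HQ.
destruct HQ as (Q' & HQ' & _); now exists Q'.
Qed.

(** After the update by [[0,a)], which is conditioning, [[0,ab)] has mass [b] and can be updated on;
    P3 composes the two updates. *)
Lemma nonvacuous_mul (a b : R) :
  0 < a < 1 -> 0 < b < 1 -> nonvacuous a -> nonvacuous b -> nonvacuous (a * b).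
Proof.
intros Ha Hb [Q HQ] Nb; assert (Hab : a * b <= a) by nra.
assert (E : Q (Ico 0 (a * b)) = b).
{ assert (La : leb (Ico 0 a) = a) by (rewrite leb_Ico; lra).
  rewrite (@update_is_cond _ leb (Ico 0 a) Q); [|lra|exact HQ].
  rewrite (meas_ext (interM (Ico 0 (a * b)) (Ico 0 a)) (Ico 0 (a * b)))
    by (simpl; intros; lra).
  rewrite La, leb_Ico by nra; field; lra. }
rewrite <- E in Nb, Hb; apply nonvacuous_iff in Nb; [|exact Hb].
destruct Nb as [Q' HQ']; exists Q'.
rewrite <- (Ico_interM Hab), update_interM; now exists Q.
Qed.

(** Some power of [a] lies below [b]; products reach it and monotonicity returns to [b]. *)
Lemma nonvacuous_all (a b : R) :
  0 < a < 1 -> 0 < b < 1 -> nonvacuous a -> nonvacuous b.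
Proof.
intros Ha Hb Na.
assert (K : forall n, 0 < a ^ S n < 1 /\ nonvacuous (a ^ S n)).
{ induction n as [|n [Hn IH]]; [simpl; rewrite Rmult_1_r; now split|].
  change (a ^ S (S n)) with (a * a ^ S n); split; [nra|].
  now apply nonvacuous_mul. }
destruct (pow_lt_1_zero a) with (y := b) as [n Hn]; [rewrite Rabs_pos_eq; lra|lra|].
specialize (Hn (S n) (le_S _ _ (le_n n))); pose proof (Rle_abs (a ^ S n)).
apply nonvacuous_mono with (a ^ S n); [lra|apply K].
Qed.

Lemma update_zero (M : MeasSpace) (P : Prob M) (B : Meas M) (Q : Prob M) :
  P B = 0 -> ~ U (single P) B Q.
Proof. intros H; apply HU; intros P' ->; exact H. Qed.

Lemma update_one (M : MeasSpace) (P : Prob M) (B : Meas M) (Q : Prob M) :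
  P B = 1 -> (U (single P) B Q <-> Q = P).
Proof. intros H; apply (@H4 _ (single P)); intros P' ->; exact H. Qed.

Lemma pr_cases (M : MeasSpace) (P : Prob M) (B : Meas M) :
  P B = 0 \/ P B = 1 \/ 0 < P B < 1.
Proof. pose proof (pr_nonneg P B); pose proof (pr_le1 P B); lra. Qed.

(** P5 reduces to single measures. Masses 0 and 1 behave alike in both families, so only
    nonemptiness at masses strictly between decides. *)
Lemma cond_or_constrain : fam_eq U Upd_cond \/ fam_eq U Upd_constrain.
Proof.
destruct (classic (exists a, 0 < a < 1 /\ nonvacuous a)) as [(a & Ha & Na)|no];
[left|right]; intros M X B Q; rewrite (H5 X B Q).
- split.
  + intros (P & HP & HQ); exists P; split; [exact HP|].
    destruct (pr_cases P B) as [E|[E|HB]]; [now apply update_zero in HQ| |].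
    * rewrite update_one in HQ by exact E; subst Q; split; [lra|].
      intros A; rewrite pr_inter_of_one, E by exact E; field.
    * split; [lra|]; now apply update_is_cond.
  + intros (P & HP & HB & HQ); exists P; split; [exact HP|].
    destruct (pr_cases P B) as [E|[E|HB']]; [lra| |].
    * rewrite update_one by exact E; apply prob_ext; intros A.
      rewrite HQ, pr_inter_of_one, E by exact E; field.
    * destruct (proj2 (nonvacuous_iff P B HB')) as [Q' HQ'];
        [now apply nonvacuous_all with a|].
      replace Q with Q'; [exact HQ'|]; apply prob_ext; intros A.
      now rewrite HQ, (update_is_cond HB' HQ').
- split.
  + intros (P & HP & HQ); split; [|now apply (H1 HQ)].
    destruct (pr_cases P B) as [E|[E|HB]]; [now apply update_zero in HQ| |].
    * rewrite update_one in HQ by exact E; now subst Q.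
    * exfalso; apply no; exists (P B); split; [exact HB|].
      apply (nonvacuous_iff P B HB); now exists Q.
  + intros [HX HB]; exists Q; split; [exact HX|]; now apply update_one.
Qed.

End Law.
End Family.

Theorem theorem4p1 :
  (is_update_family Upd_cond /\ all_postulates Upd_cond) /\
  (is_update_family Upd_constrain /\ all_postulates Upd_constrain) /\
  (forall U : Family, is_update_family U -> all_postulates U ->
     fam_eq U Upd_cond \/ fam_eq U Upd_constrain).
Proof.
split; [exact (conj cond_update cond_postulates)|].
split; [exact (conj constrain_update constrain_postulates)|].
intros U HU (H1 & H2 & H3 & H4 & H5 & H6).
apply cond_or_constrain; trivial; now apply postulate_split_law.
Qed.
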